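(* Let $p$ be a prime, let $n\ge 1$ be an integer, and let $t\in\{-\infty,0,1,\dots,n-1\}$. Then there exist a field $F$ with $\operatorname{char}F\neq p$ containing a primitive $p$th root of unity $\xi_p$ and a cyclic Galois extension $K/F$ of degree $p^n$ such that $m(K/F)=t$.
   Context: Let $p$ be a prime and $K/F$ a cyclic Galois extension of degree $p^n$, $n\ge 1$, with $\operatorname{char}F\ne p$ and $F$ containing a primitive $p$th root of unity $\xi_p$. For $0\le i\le n$ let $K_i$ be the unique intermediate field $F\subseteq K_i\subseteq K$ with $[K_i:F]=p^i$. Define $$m(K/F)=\begin{cases}-\infty, & \xi_p\in N_{K/F}(K^\times),\\ \min\{s\in\{0,\dots,n\} : \xi_p\in N_{K/K_s}(K^\times)\}-1, & \xi_p\notin N_{K/F}(K^\times).\end{cases}$$ Here $N_{K/K_s}$ denotes the field norm. *)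

(* Defs.v *)
From HB Require Import structures.
From mathcomp Require Import all_boot all_order all_fingroup all_algebra.
From mathcomp Require Import all_solvable all_field.
From mathcomp Require Import boolp classical_sets constructive_ereal.

Set Implicit Arguments.
Unset Strict Implicit.
Unset Printing Implicit Defensive.

Import Order.TTheory GRing.Theory Num.Theory.
Local Open Scope ring_scope.

(* An extension K/F is represented by K : splittingFieldType F: every finite
   Galois extension carries this structure. The base field F, seen inside K, is
   the subfield 1%AS, K itself is {:K}, and \dim is the F-dimension. *)

Definition cyclic_galois_ext (F : fieldType) (K : splittingFieldType F)
    (d : nat) : Prop :=
  [/\ galois 1 {:K}, cyclic 'Gal({:K} / 1) & \dim {:K} = d].

(* K_i. The value is meaningful when there is exactly one subfield of degree
   p ^ i over F; see layer_exists_unique. *)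
Definition layer (F : fieldType) (K : splittingFieldType F) (p i : nat) :
    {subfield K} :=
  xget 1%AS (fun E : {subfield K} => \dim E = (p ^ i)%N).

Definition norm_group (F : fieldType) (K : splittingFieldType F)
    (E : {subfield K}) : set K :=
  [set galNorm E {:K} a | a in [set a | a != 0]]%classic.

(* For xi a primitive p-th root of unity and K/F cyclic of degree p ^ n, the
   default s = n satisfies the condition (layer_top_norm), so the arg min is the
   minimum over s in {0, ..., n}. The "- 1" is a subtraction in int. *)
Definition m_inv (F : fieldType) (K : splittingFieldType F) (p n : nat)
    (xi : F) : \bar int :=
  if `[< norm_group 1%AS (xi%:A : K) >] then -oo%E
  else let s0 := [arg min_(s < @ord_max n |
                    `[< norm_group (layer K p s) (xi%:A : K) >]) nat_of_ord s] in
       ((nat_of_ord s0)%:Z - 1)%:E%E.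

Lemma layer_exists_unique (F : fieldType) (K : splittingFieldType F)
    (p n i : nat) :
    prime p -> cyclic_galois_ext K (p ^ n) -> (i <= n)%N ->
  exists! E : {subfield K}, \dim E = (p ^ i)%N.
Proof.
move=> p_pr [galK cycG dimK] le_in.
have p_gt0 := prime_gt0 p_pr.
have cardG : #|'Gal({:K} / 1)%g| = (p ^ n)%N.
  by rewrite -(galois_dim galK) dimv1 divn1.
have galE (E : {subfield K}) : galois E {:K}.
  by apply: galoisS galK; rewrite sub1v subvf.
have cardE (E : {subfield K}) : \dim E = (p ^ i)%N ->
    #|'Gal({:K} / E)%g| = (p ^ (n - i))%N.
  by move=> dimE; rewrite -(galois_dim (galE E)) dimK dimE -expnB.
have subG (E : {subfield K}) : ('Gal({:K} / E) \subset 'Gal({:K} / 1))%g.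
  by apply: galS; rewrite sub1v.
have [x defG] := cyclicP cycG.
have [H [sHG oH]] : (exists H : {group gal_of {:K}},
    (H \subset 'Gal({:K} / 1))%g /\ #|H| = (p ^ (n - i))%N).
  exists <[(x ^+ (p ^ i)%N)%g]>%G; split; first by rewrite defG /= cycleX.
  have ox : #[x]%g = (p ^ n)%N by rewrite /order -defG.
  by rewrite -orderE orderXdiv ox ?dvdn_exp2l // expnB.
exists [aspace of fixedField H]; split.
  have /= := dim_fixed_galois galK sHG.
  rewrite dimv1 divn1 => ->.
  by rewrite -divgS // cardG oH -expnB ?leq_subr // subKn.
move=> E dimE; apply/val_inj => /=.
have eqH : H = 'Gal({:K} / E)%g :> {set _}.
  by apply/eqP; rewrite (eq_subG_cyclic cycG sHG (subG E)) oH cardE.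
by rewrite eqH; apply/galois_fixedField.
Qed.

Lemma layerP (F : fieldType) (K : splittingFieldType F) (p n i : nat) :
    prime p -> cyclic_galois_ext K (p ^ n) -> (i <= n)%N ->
  \dim (layer K p i) = (p ^ i)%N.
Proof.
move=> p_pr extK le_in.
have [E [dimE _]] := layer_exists_unique p_pr extK le_in.
exact: (xgetI 1%AS (P := fun E : {subfield K} => \dim E = (p ^ i)%N) dimE).
Qed.

Lemma layer_top_norm (F : fieldType) (K : splittingFieldType F) (p n : nat)
    (xi : F) :
    prime p -> cyclic_galois_ext K (p ^ n) -> xi != 0 ->
  norm_group (layer K p n) (xi%:A : K).
Proof.
move=> p_pr extK xi_neq0; have [_ _ dimK] := extK.
have layerT : layer K p n = {:K}%AS.
  apply/val_inj/eqP => /=.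
  by rewrite (eqEdim (layer K p n)) subvf dimK (layerP p_pr extK) /=.
exists xi%:A; first by rewrite /= scaler_eq0 oner_eq0 orbF.
have galT : 'Gal({:K} / {:K})%g = [set 1%g].
  apply/setP => x; rewrite inE; apply/idP/eqP => [galx|->]; last exact: group1.
  apply/eqP/gal_eqP => a Ka; rewrite gal_id.
  exact: (fixed_gal (subvv _) galx Ka).
by rewrite layerT /galNorm galT big_set1 gal_id.
Qed.

(* Main.v *)
Require Import Defs.
From mathcomp Require Import all_boot all_order all_fingroup all_algebra.
From mathcomp Require Import all_solvable all_field.
From mathcomp Require Import boolp classical_sets constructive_ereal.
From HB Require Import structures.
From mathcomp Require Import zify.
From mathcomp Require Import -(notations) mpoly.

(* Put m = p^k and q = p^(n-k), and let E be a field containing a primitive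
   q-th root of unity z. On K = E(y_0, ..., y_(m-1)) let sigma be the
   E-automorphism y_0 -> y_1 -> ... -> y_(m-1) -> z y_0. It has order mq = p^n,
   so K is cyclic of degree p^n over F = K^sigma (Artin), and sigma^m, which
   generates Gal(K/K_k), multiplies every variable by z. It therefore preserves
   leading monomials, so if the norm from K to K_k of P/Q is a constant c, then
   P and Q have the same leading monomial and comparing leading coefficients
   gives c = (lc P / lc Q)^q. Hence c in E is such a norm iff it is a q-th
   power in E.

   For E = Q(z) and xi = z^(q/p), xi is no q-th power, since E contains no
   primitive pq-th root of unity; so xi is not a norm from K to K_k, whereas it
   is the norm of z from K to K_(k+1), and m(K/F) = k. For m(K/F) = -oo, take
   k = 0 and let E contain a primitive p^(n+1)-th root of unity w: with
   z = w^p, xi = w^(p^n) is the norm of w from K to F. *)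

Set Implicit Arguments.
Unset Strict Implicit.
Unset Printing Implicit Defensive.

Import Order.TTheory GRing.Theory Num.Theory.
Local Open Scope ring_scope.

(** * Norms in a cyclic extension of prime power degree *)

Lemma big_cycle (R : Type) (idx : R) (op : Monoid.com_law idx)
    (gT : finGroupType) (x : gT) (f : gT -> R) :
  \big[op/idx]_(y in <[x]>%g) f y = \big[op/idx]_(0 <= i < #[x]%g) f (x ^+ i)%g.
Proof.
have -> : <[x]>%g = [set (x ^+ (i : 'I_#[x]%g))%g | i in [set: 'I_#[x]%g]].
  apply/setP => y; apply/idP/imsetP => [/cyclePmin[i lt_i ->] | [i _ ->]].
    by exists (Ordinal lt_i).
  exact: mem_cycle.
rewrite big_imset => [|i j _ _ /eqP]; last first.
  by rewrite eq_expg_mod_order !modn_small // => /eqP/val_inj.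
by rewrite big_mkord; apply: eq_bigl => i; rewrite inE.
Qed.

Section MInvariant.

Variables (F : fieldType) (K : splittingFieldType F) (p n : nat).
Hypotheses (p_pr : prime p) (extK : cyclic_galois_ext K (p ^ n)).

(** A cyclic group has one subgroup of each possible order, so Gal(K/K_s) is generated by
    [g ^+ (p ^ s)] and norms to K_s become explicit products. *)
Lemma norm_group_layerP (g : gal_of {:K}) s (x : K) :
    'Gal({:K} / 1)%g = <[g]>%g -> (s <= n)%N ->
  norm_group (layer K p s) x <->
  exists2 a, a != 0 & \prod_(0 <= i < p ^ (n - s)) (g ^+ (p ^ s * i))%g a = x.
Proof.
move=> defG le_sn; have [galK cycG dimK] := extK.
have p_gt0 := prime_gt0 p_pr.
have og : #[g]%g = (p ^ n)%N.
  by rewrite /order -defG -(galois_dim galK) dimv1 divn1.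
have ogs : #[(g ^+ (p ^ s))%g]%g = (p ^ (n - s))%N.
  by rewrite orderXdiv og ?dvdn_exp2l // expnB.
have galE : galois (layer K p s) {:K}.
  by apply: galoisS galK; rewrite sub1v subvf.
have sgs : (<[g ^+ (p ^ s)]> \subset 'Gal({:K} / 1))%g by rewrite defG cycleX.
have sGs : ('Gal({:K} / layer K p s) \subset 'Gal({:K} / 1))%g.
  by apply: galS; rewrite sub1v.
have defGs : 'Gal({:K} / layer K p s)%g = <[g ^+ (p ^ s)]>%g.
  apply/eqP; rewrite (eq_subG_cyclic cycG sGs sgs) -orderE ogs.
  by rewrite -(galois_dim galE) dimK (layerP p_pr extK le_sn) -expnB.
have normE a : galNorm (layer K p s) {:K} a =
    \prod_(0 <= i < p ^ (n - s)) (g ^+ (p ^ s * i))%g a.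
  rewrite /galNorm defGs big_cycle ogs.
  by apply: eq_bigr => i _; rewrite expgM.
by split=> [[a a0 <-] | [a a0 <-]]; exists a.
Qed.

(** A form of transitivity of the norm. It lets failure at one level rule out all lower levels, as
    the minimum in [m_inv] requires. *)
Lemma norm_group_layerS s s' (x : K) : (s <= s' <= n)%N ->
  norm_group (layer K p s) x -> norm_group (layer K p s') x.
Proof.
case/andP=> le_ss' le_s'n; have [_ /cyclicP[g defG] _] := extK.
case/(norm_group_layerP _ defG (leq_trans le_ss' le_s'n)) => a a0 <-.
apply/(norm_group_layerP _ defG le_s'n).
(* The product runs over coset representatives of Gal(K/K_s') in Gal(K/K_s). *)
exists (\prod_(0 <= r < p ^ (s' - s)) (g ^+ (p ^ s * r))%g a).
  by rewrite prodf_seq_neq0; apply/allP => r _ /=; rewrite fmorph_eq0.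
have -> : (n - s = (n - s') + (s' - s))%N by lia.
rewrite expnD big_nat_mul; apply: eq_bigr => i _.
rewrite rmorph_prod /= mulSn -[(i * _)%N]add0n [RHS]big_addn add0n addnK.
apply: eq_bigr => r _; rewrite -galM ?memvf // -expgD; congr ((g ^+ _)%g a).
by rewrite [RHS]mulnDr mulnCA -expnD subnKC // [(i * _)%N]mulnC.
Qed.

Lemma norm_group_layerX s (x : F) : (s <= n)%N -> x != 0 ->
  norm_group (layer K p s) ((x ^+ (p ^ (n - s)))%:A : K).
Proof.
move=> le_sn x0; have [_ /cyclicP[g defG] _] := extK.
apply/(norm_group_layerP _ defG le_sn).
exists (x%:A); first by rewrite scaler_eq0 oner_eq0 orbF.
rewrite (eq_bigr (fun=> x%:A)) => [|i _]; last by rewrite linearZ_LR rmorph1.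
by rewrite prodr_const_nat subn0 exprZn expr1n.
Qed.

Lemma layer0 : layer K p 0 = 1%AS.
Proof.
apply/val_inj/esym/eqP; rewrite /= (eqEdim 1) sub1v dimv1.
by rewrite (layerP p_pr extK).
Qed.

Lemma m_inv_ninfty xi :
  norm_group (layer K p 0) (xi%:A : K) -> m_inv K p n xi = -oo%E.
Proof. by rewrite layer0 /m_inv => /asboolP ->. Qed.

(** By [norm_group_layerS] the minimum in [m_inv] is attained at k + 1, and subtracting 1 returns
    k. *)
Lemma m_inv_fin xi k : (k < n)%N ->
    ~ norm_group (layer K p k) (xi%:A : K) ->
    norm_group (layer K p k.+1) (xi%:A : K) -> xi != 0 ->
  m_inv K p n xi = (k%:Z%:E)%E.
Proof.
move=> lt_kn not_normk normSk xi0; rewrite /m_inv -layer0.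
have not_norm s : (s <= k)%N -> ~ norm_group (layer K p s) (xi%:A : K).
  move=> le_sk /(@norm_group_layerS s k)/not_normk; apply.
  by rewrite le_sk ltnW.
rewrite (introF (asboolP _)); last exact: not_norm.
case: arg_minnP => [|s /asboolP norm_s min_s].
  exact/asboolP/layer_top_norm.
have lt_kn' : (k.+1 < n.+1)%N by [].
have := min_s (Ordinal lt_kn') (introT (asboolP _) normSk) => /= le_s.
have -> : nat_of_ord s = k.+1.
  apply/eqP; rewrite eqn_leq le_s ltnNge.
  by apply/negP => /not_norm; apply.
by rewrite intS addrAC subrr add0r.
Qed.

End MInvariant.

(** * The fixed field of an automorphism of finite order *)

Section FixedField.

Variables (K : fieldType) (sigma : {rmorphism K -> K}).

Definition fixed_pred : pred K := [pred x | sigma x == x].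

Fact fixed_pred_divring_closed : divring_closed fixed_pred.
Proof.
split=> [|x y|x y]; rewrite !inE ?rmorph1 //.
  by move=> /eqP fx /eqP fy; rewrite rmorphB fx fy.
by move=> /eqP fx /eqP fy; rewrite fmorph_div fx fy.
Qed.

HB.instance Definition _ :=
  GRing.isDivringClosed.Build K fixed_pred fixed_pred_divring_closed.

Definition fixed_field := {x : K | fixed_pred x}.

HB.instance Definition _ := SubChoice.on fixed_field.
HB.instance Definition _ :=
  [SubChoice_isSubIntegralDomain of fixed_field by <:].
HB.instance Definition _ := [SubIntegralDomain_isSubField of fixed_field by <:].

Lemma fixed_fieldP (x : fixed_field) : sigma (val x) = val x.
Proof. exact/eqP/(valP x). Qed.

End FixedField.

Section IterRMorphism.

Variables (R : pzRingType) (sigma : {rmorphism R -> R}).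

Fact iter_is_zmod_morphism i : zmod_morphism (iter i sigma).
Proof. by move=> x y; elim: i => //= i ->; rewrite rmorphB. Qed.

Fact iter_is_monoid_morphism i : monoid_morphism (iter i sigma).
Proof.
by split=> [|x y]; elim: i => //= i ->; rewrite (rmorph1, rmorphM).
Qed.

HB.instance Definition _ i :=
  GRing.isZmodMorphism.Build R R (iter i sigma) (iter_is_zmod_morphism i).
HB.instance Definition _ i :=
  GRing.isMonoidMorphism.Build R R (iter i sigma) (iter_is_monoid_morphism i).

End IterRMorphism.

(** * Artin's theorem: the field as a cyclic extension of the fixed field *)

Section CyclicExtension.

Variables (K : fieldType) (sigma : {rmorphism K -> K}) (N : nat) (theta : K).

Lemma iter_fixed_field i (x : fixed_field sigma) :
  iter i sigma (val x) = val x.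
Proof. by elim: i => //= i ->; apply: fixed_fieldP. Qed.

(** Injectivity makes sigma of order exactly N and theta a primitive element over the fixed field,
    with N distinct conjugates. *)
Definition free_orbit :=
  [/\ (0 < N)%N, iter N sigma =1 id &
      {in gtn N &, injective (fun i => iter i sigma theta)}].

(* K as an extension of the fixed field of sigma; the proof argument keeps N and
   theta, needed by the instances below, in the type. *)
Definition cyclic_ext of free_orbit : Type := K.

Hypothesis orbN : free_orbit.

Let N_gt0 : (0 < N)%N. Proof. by case: orbN. Qed.
Let sigmaN : iter N sigma =1 id. Proof. by case: orbN. Qed.
Let theta_inj : {in gtn N &, injective (fun i => iter i sigma theta)}.
Proof. by case: orbN. Qed.

Local Notation F := (fixed_field sigma).
Local Notation L := (cyclic_ext orbN).

HB.instance Definition _ := GRing.Field.on L.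

Definition cyclic_scale (a : F) (u : L) : L := val a * u.

Fact cyclic_scaleA a b u :
  cyclic_scale a (cyclic_scale b u) = cyclic_scale (a * b) u.
Proof. by rewrite /cyclic_scale rmorphM mulrA. Qed.

Fact cyclic_scale1 : left_id 1 cyclic_scale.
Proof. by move=> u; rewrite /cyclic_scale rmorph1 mul1r. Qed.

Fact cyclic_scaleDr : right_distributive cyclic_scale +%R.
Proof. by move=> a u v; rewrite /cyclic_scale mulrDr. Qed.

Fact cyclic_scaleDl v : {morph cyclic_scale^~ v : a b / a + b}.
Proof. by move=> a b; rewrite /cyclic_scale rmorphD mulrDl. Qed.

HB.instance Definition _ := GRing.Zmodule_isLmodule.Build F L
  cyclic_scaleA cyclic_scale1 cyclic_scaleDr cyclic_scaleDl.

Fact cyclic_scaleAl (a : F) (u v : L) : a *: (u * v) = (a *: u) * v.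
Proof. exact: mulrA. Qed.

HB.instance Definition _ := GRing.Lmodule_isLalgebra.Build F L cyclic_scaleAl.

Fact cyclic_scaleAr (a : F) (u v : L) : a *: (u * v) = u * (a *: v).
Proof. exact: mulrCA. Qed.

HB.instance Definition _ := GRing.Lalgebra_isAlgebra.Build F L cyclic_scaleAr.

Lemma cyclic_scaleE (a : F) (u : L) : a *: u = val a * u :> K.
Proof. by []. Qed.

Definition orbit_mx : 'M[K]_N :=
  Vandermonde N (\row_l iter (l : 'I_N) sigma theta).

Fact orbit_Vandermonde_unit : orbit_mx \in unitmx.
Proof.
rewrite unitmxE det_Vandermonde unitfE; apply/prodf_neq0 => i _.
apply/prodf_neq0 => j lt_ij; rewrite !mxE subr_eq0; apply/eqP => eq_ij.
by have := theta_inj (ltn_ord j) (ltn_ord i) eq_ij; lia.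
Qed.

Definition orbit_coord (a : K) : 'rV[K]_N :=
  (\row_l iter (l : 'I_N) sigma a) *m invmx orbit_mx.

Fact orbit_coordE a (l : 'I_N) :
  \sum_i orbit_coord a 0 i * iter l sigma theta ^+ i = iter l sigma a.
Proof.
have: orbit_coord a *m orbit_mx = \row_l iter (l : 'I_N) sigma a.
  by rewrite mulmxKV // orbit_Vandermonde_unit.
move/rowP/(_ l); rewrite !mxE => <-.
by apply: eq_bigr => i _; rewrite !mxE.
Qed.

Fact orbit_coord_unique a (d : 'rV[K]_N) :
    (forall l : 'I_N,
      \sum_i d 0 i * iter l sigma theta ^+ i = iter l sigma a) ->
  d = orbit_coord a.
Proof.
move=> dE; rewrite -[d](mulmxK orbit_Vandermonde_unit); congr (_ *m _).
apply/rowP => l; rewrite !mxE -dE.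
by apply: eq_bigr => i _; rewrite !mxE.
Qed.

Fact orbit_coord_fixed a i : fixed_pred sigma (orbit_coord a 0 i).
Proof.
suffices /rowP/(_ i): map_mx sigma (orbit_coord a) = orbit_coord a.
  by rewrite !mxE => /eqP.
apply: orbit_coord_unique => l.
(* [l'] is l - 1 modulo N: equation l is the image under sigma of equation [l'], also for l = 0
   because sigma^N is the identity. *)
pose l' := Ordinal (ltn_pmod (l + N.-1) N_gt0).
have iterS x : iter l sigma x = sigma (iter l' sigma x).
  rewrite /= -iterS; have [l0 | l_gt0] := posnP l.
    by rewrite l0 add0n modn_small prednK // sigmaN.
  have -> : (l + N.-1 = N + l.-1)%N by lia.
  by rewrite modnDl modn_small prednK // ltnW.
rewrite [RHS]iterS -(orbit_coordE a) rmorph_sum.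
by apply: eq_bigr => k _; rewrite mxE rmorphM rmorphXn [iter l _ _]iterS.
Qed.

(* Artin's theorem: the coordinates of a on 1, theta, theta^2, ... solve the
   Vandermonde system obtained by applying the iterates of sigma to
   a = sum_i c_i theta^i; sigma permutes its equations and so fixes c. *)
Fact cyclic_vect_axiom : Vector.axiom N L.
Proof.
pose r2v (v : 'rV[F]_N) : L := \sum_i v 0 i *: (theta ^+ i : L).
have r2v_lin: linear r2v.
  move=> a u v; rewrite /r2v scaler_sumr -big_split /=; apply: eq_bigr => i _.
  by rewrite scalerA -scalerDl !mxE.
pose r2vlM := GRing.isLinear.Build _ _ _ _ r2v r2v_lin.
pose r2vL : {linear _ -> _} := HB.pack r2v r2vlM.
pose v2r (x : L) : 'rV[F]_N :=
  \row_i exist _ (orbit_coord x 0 i) (orbit_coord_fixed x i).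
have v2rK: cancel v2r r2vL.
  move=> x; rewrite /= /r2v -[RHS](orbit_coordE x (Ordinal N_gt0)).
  by apply: eq_bigr => i _; rewrite mxE.
suffices r2vK: cancel r2v v2r.
  by exists v2r; [apply: can2_linear v2rK | exists r2v].
move=> v; apply/rowP => i; apply/val_inj.
have /rowP/(_ i) : map_mx val v = orbit_coord (r2v v).
  apply: orbit_coord_unique => l; rewrite /r2v.
  rewrite rmorph_sum; apply: eq_bigr => k _.
  by rewrite mxE cyclic_scaleE rmorphM rmorphXn /= iter_fixed_field.
by rewrite [LHS]mxE => ->; rewrite [v2r _ _ _]mxE.
Qed.

HB.instance Definition _ := Lmodule_hasFinDim.Build F L cyclic_vect_axiom.

Lemma dim_cyclic_ext : \dim {:L} = N.
Proof. by rewrite dimvf. Qed.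

Lemma mem_cyclic_ext1 (x : L) : (x \in 1%VS) = (sigma x == x).
Proof.
apply/vlineP/idP => [[a ->] | fx].
  by rewrite cyclic_scaleE mulr1 fixed_fieldP.
by exists (exist _ x fx); rewrite cyclic_scaleE mulr1.
Qed.

Definition orbit_seq : seq L := [seq iter i sigma theta | i <- index_iota 0 N].
Definition orbit_poly : {poly L} := \prod_(z <- orbit_seq) ('X - z%:P).

(** sigma sends each linear factor to the next one and the last to the first. *)
Fact cyclic_poly_fixed : orbit_poly \is a polyOver 1%VS.
Proof.
apply/polyOverP => i; rewrite mem_cyclic_ext1 -(coef_map sigma).
suffices -> : map_poly sigma orbit_poly = orbit_poly by [].
rewrite /orbit_poly big_map rmorph_prod /= -(prednK N_gt0).
rewrite [LHS]big_nat_recr // [RHS]big_nat_recl //= mulrC; congr (_ * _).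
  by rewrite rmorphB /= map_polyX map_polyC /= -iterS prednK // sigmaN.
by apply: eq_bigr => j _; rewrite rmorphB /= map_polyX map_polyC.
Qed.

(** The powers of theta, one of the roots, already span [L] over the fixed field. *)
Fact cyclic_splitting_poly : splittingFieldFor 1 orbit_poly {:L}.
Proof.
exists orbit_seq; first exact: eqpxx.
apply/eqP; rewrite eqEsubv subvf; apply/subvP => x _.
have Ltheta : (theta : L) \in <<1 & orbit_seq>>%VS.
  apply: seqv_sub_adjoin; apply/mapP; exists 0%N => //.
  by rewrite mem_index_iota.
rewrite -[x](orbit_coordE x (Ordinal N_gt0)); apply: rpred_sum => i _.
apply: rpredM; last exact: rpredX.
by apply/(subvP (sub1v _)); rewrite mem_cyclic_ext1; apply: orbit_coord_fixed.
Qed.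

HB.instance Definition _ := FieldExt_isSplittingField.Build F L
  (ex_intro2 _ _ orbit_poly cyclic_poly_fixed cyclic_splitting_poly).

Lemma galois_cyclic_ext : galois 1 {:L}.
Proof.
apply/splitting_galoisField; exists orbit_poly; split.
- exact: cyclic_poly_fixed.
- rewrite separable_prod_XsubC map_inj_in_uniq ?iota_uniq // => i j.
  by rewrite !mem_index_iota; apply: theta_inj.
- exact: cyclic_splitting_poly.
Qed.

(** The generator is sigma itself: it lies in a group of order N, and no iterate of positive index
    below N fixes theta. *)
Lemma cyclic_ext_gal : exists g : gal_of {:L},
  (forall i x, (g ^+ i)%g x = iter i sigma x) /\ 'Gal({:L} / 1)%g = <[g]>%g.
Proof.
have sigma_lin : linear (sigma : L -> L).
  by move=> a u v; rewrite rmorphD !cyclic_scaleE rmorphM fixed_fieldP.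
pose sigmaLM := GRing.isLinear.Build _ _ _ _ (sigma : L -> L) sigma_lin.
pose sigmaL : {linear L -> L} := HB.pack (sigma : L -> L) sigmaLM.
have fE x : linfun sigmaL x = sigma x by rewrite lfunE.
have autf : kAut 1 {:L} (linfun sigmaL).
  rewrite kAutE subvf andbT; apply/kHomP_tmp; split=> [x | x y _ _].
    by rewrite fE mem_cyclic_ext1 => /eqP.
  by rewrite !fE rmorphM.
have [g galg gE] := kAut_to_gal autf.
have {}gE x : g x = sigma x by rewrite -gE ?memvf ?fE.
have gX i x : (g ^+ i)%g x = iter i sigma x.
  elim: i x => [|i IHi] x; first by rewrite expg0 gal_id.
  by rewrite expgSr galM ?memvf // gE IHi.
have cardG : #|'Gal({:L} / 1)%g| = N.
  by rewrite -(galois_dim galois_cyclic_ext) dimv1 divn1 dim_cyclic_ext.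
have og : #[g]%g = N.
  apply/eqP; rewrite eqn_leq -{1}cardG subset_leq_card ?cycle_subG //=.
  rewrite leqNgt; apply/negP => lt_gN.
  have := theta_inj lt_gN N_gt0.
  rewrite /= -gX expg_order gal_id => /(_ erefl) g0.
  by have := order_gt0 g; rewrite g0.
exists g; split; [exact: gX | apply/eqP].
by rewrite eq_sym eqEcard cycle_subG galg -orderE og cardG /=.
Qed.

End CyclicExtension.

(** * Lifting an injective morphism to the field of fractions *)

Local Notation "x %:F" := (@FracField.tofrac _ x).

Lemma fracE (R : idomainType) (x : {fraction R}) :
  x = (\n_(generic_quotient.repr x))%:F / (\d_(generic_quotient.repr x))%:F.
Proof.
apply: (canRL (mulfK _)); first by rewrite tofrac_eq0 denom_ratioP.
rewrite -{1}[x]reprK; unlock FracField.tofrac.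
rewrite -[LHS]FracField.pi_mul; apply/eqmodP.
rewrite /= FracField.equivfE /FracField.mulf !numden_Ratio;
  rewrite ?mulf_neq0 ?oner_neq0 ?denom_ratioP //.
by rewrite !mulr1 mulrC.
Qed.

Section FracLift.

Variables (R : idomainType) (L : fieldType) (f : {rmorphism R -> L}).
Hypothesis f_inj : injective f.

(* The argument [injective f] is not computed with: it is what the morphism
   instances below are inferred from. *)
Definition frac_lift of injective f := fun x : {fraction R} =>
  f \n_(generic_quotient.repr x) / f \d_(generic_quotient.repr x).

Local Notation lift := (frac_lift f_inj).

Let f_neq0 a : a != 0 -> f a != 0.
Proof. by rewrite -(rmorph0 f) (inj_eq f_inj). Qed.

(** Independence of the chosen representative: two fractions are compared by cross multiplication,
    and injectivity keeps the images of denominators nonzero. *)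
Lemma frac_lift_div a b : b != 0 -> lift (a%:F / b%:F) = f a / f b.
Proof.
move=> b0; rewrite /frac_lift; set x := a%:F / b%:F.
have d0 : \d_(generic_quotient.repr x) != 0 by apply: denom_ratioP.
apply/eqP; rewrite eqr_div ?f_neq0 // -!rmorphM (inj_eq f_inj) -tofrac_eq.
by rewrite !rmorphM -eqr_div ?tofrac_eq0 // -fracE.
Qed.

Lemma frac_lift_tofrac a : lift a%:F = f a.
Proof.
rewrite -[a%:F]divr1 -(rmorph1 (@FracField.tofrac R)).
by rewrite frac_lift_div ?oner_neq0 // rmorph1 divr1.
Qed.

Fact frac_lift_is_zmod_morphism : zmod_morphism lift.
Proof.
have subf_div (M : fieldType) (x y z t : M) : y != 0 -> t != 0 ->
    x / y - z / t = (x * t - z * y) / (y * t).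
  by move=> y0 t0; rewrite -[- (z / t)]mulNr addf_div // mulNr.
move=> x y; rewrite (fracE x) (fracE y).
set a := \n__; set b := \d__; set c := \n__; set d := \d__.
have [b0 d0] : b != 0 /\ d != 0 by split; apply: denom_ratioP.
rewrite subf_div ?tofrac_eq0 // -!rmorphM -rmorphB !frac_lift_div ?mulf_neq0 //.
by rewrite subf_div ?f_neq0 // rmorphB !rmorphM.
Qed.

Fact frac_lift_is_monoid_morphism : monoid_morphism lift.
Proof.
split=> [|x y].
  by rewrite -(rmorph1 (@FracField.tofrac R)) frac_lift_tofrac rmorph1.
rewrite (fracE x) (fracE y).
set a := \n__; set b := \d__; set c := \n__; set d := \d__.
have [b0 d0] : b != 0 /\ d != 0 by split; apply: denom_ratioP.
by rewrite mulf_div -!rmorphM !frac_lift_div ?mulf_neq0 // mulf_div -!rmorphM.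
Qed.

HB.instance Definition _ := GRing.isZmodMorphism.Build {fraction R} L lift
  frac_lift_is_zmod_morphism.
HB.instance Definition _ := GRing.isMonoidMorphism.Build {fraction R} L lift
  frac_lift_is_monoid_morphism.

End FracLift.

(** * The twisted cyclic shift of the variables *)

Local Notation mleadc P := (mcoeff (mlead P) P).

Lemma prim_root_neq0 (E : nzRingType) q (z : E) : q.-primitive_root z -> z != 0.
Proof.
move=> prim_z; apply/eqP => z0; move/eqP: (prim_expr_order prim_z).
by rewrite z0 expr0n eqn0Ngt (prim_order_gt0 prim_z) eq_sym oner_eq0.
Qed.

(** * Endomorphisms multiplying every variable by the same constant *)

Section Scaling.

Variables (E : fieldType) (m : nat) (d : E).
Variable tau : {rmorphism mpoly m E -> mpoly m E}.
Hypothesis tauC : forall c, tau (mpolyC m c) = mpolyC m c.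
Hypothesis tauX : forall i, tau (mpolyX E (mnm1 i)) = d *: mpolyX E (mnm1 i).

(** Each monomial is an eigenvector of [tau], with eigenvalue depending only on its total degree. *)
Lemma scaling_mcoeff P mon : mcoeff mon (tau P) = d ^+ mdeg mon * mcoeff mon P.
Proof.
have tauM k : tau (mpolyX E k) = d ^+ mdeg k *: mpolyX E k.
  rewrite mpolyXE_id rmorph_prod mdegE -prodrXr -scaler_prod.
  by apply: eq_bigr => i _; rewrite rmorphXn /= tauX exprZn.
have -> : mcoeff mon P = \sum_(k <- msupp P) mcoeff k P * (k == mon)%:R.
  rewrite {1}[P]mpolyE raddf_sum; apply: eq_bigr => k _ /=.
  by rewrite mcoeffZ mcoeffX.
rewrite {1}[P]mpolyE rmorph_sum raddf_sum mulr_sumr; apply: eq_bigr => k _ /=.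
rewrite -mul_mpolyC rmorphM /= tauC tauM mul_mpolyC !mcoeffZ mcoeffX.
by have [-> | _] := eqVneq k mon; rewrite ?mulr0 // !mulr1 mulrC.
Qed.

Hypothesis d_neq0 : d != 0.

(** Nonzero factors preserve the support, which alone determines the leading monomial. *)
Lemma scaling_mlead P : mlead (tau P) = mlead P.
Proof.
apply: perm_big; apply: uniq_perm; rewrite ?msupp_uniq // => k.
by rewrite !mcoeff_msupp scaling_mcoeff mulf_eq0 expf_eq0 (negPf d_neq0) andbF.
Qed.

Lemma scaling_mleadc P : mleadc (tau P) = d ^+ mdeg (mlead P) * mleadc P.
Proof. by rewrite scaling_mlead scaling_mcoeff. Qed.

End Scaling.

Section Shift.

Variables (E : fieldType) (m' : nat) (z : E).
Local Notation m := m'.+1.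
Local Notation R := (mpoly m E).
Local Notation X i := (mpolyX E (mnm1 i)).

(** The factor [z] sits at the last index, where [ordS] wraps around to 0. The number of variables
    is a successor so that y_0 exists. *)
Definition shift : R -> R :=
  mmap (@mpolyC m E)
    (fun i => (if i.+1 == m then z else 1) *: X (ordS i)).

HB.instance Definition _ := GRing.RMorphism.on shift.

Lemma shiftC c : shift (mpolyC m c) = mpolyC m c.
Proof. exact: mmapC. Qed.

Lemma shiftX i :
  shift (X i) = (if i.+1 == m then z else 1) *: X (ordS i).
Proof. by rewrite /shift mmapX mmap1U. Qed.

Lemma iter_shiftC i c : iter i shift (mpolyC m c) = mpolyC m c.
Proof. by elim: i => //= i ->; apply: shiftC. Qed.

(** The quotient by m counts the passages from the last variable back to y_0, each contributing one
    [z]. *)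
Lemma iter_shiftX i (j : 'I_m) :
  iter i shift (X j) = z ^+ ((j + i) %/ m) *: X (inord ((j + i) %% m)).
Proof.
elim: i => [|i IHi] /=.
  by rewrite addn0 divn_small // modn_small // scale1r inord_val.
rewrite IHi -mul_mpolyC rmorphM /= shiftC shiftX mul_mpolyC scalerA addnS.
set k := (j + i)%N; have lt_km : (k %% m < m)%N by rewrite ltn_mod.
rewrite inordK //; congr (_ *: mpolyX E (mnm1 _)).
  have [eq_m | neq_m] := eqVneq.
    rewrite {2}(divn_eq k m) -addnS eq_m -mulSnr mulnK //.
    by rewrite exprSr.
  rewrite {2}(divn_eq k m) -addnS divnMDl // [(_.+1 %/ m)%N]divn_small.
    by rewrite addn0 mulr1.
  by move: lt_km neq_m; rewrite leq_eqVlt => /orP[->|].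
by apply/val_inj; rewrite /= !inordK ?ltn_mod // -[in LHS]addn1 modnDml addn1.
Qed.

Variable q : nat.
Hypothesis prim_z : q.-primitive_root z.

Let q_gt0 : (0 < q)%N := prim_order_gt0 prim_z.
Let z_neq0 : z != 0 := prim_root_neq0 prim_z.

Lemma iter_shiftX_mul b (j : 'I_m) : iter (m * b) shift (X j) = z ^+ b *: X j.
Proof.
rewrite iter_shiftX mulnC addnC divnMDl // modnMDl.
by rewrite divn_small // modn_small // addn0 inord_val.
Qed.

(** After m q steps each variable has gained z^q = 1, so this is scaling with d = 1. *)
Lemma iter_shift_order : iter (m * q) shift =1 id.
Proof.
move=> P; apply/mpolyP => k.
rewrite (@scaling_mcoeff _ _ 1 (iter (m * q) shift)).
- by rewrite expr1n mul1r.
- by move=> c; rewrite /= iter_shiftC.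
- by move=> j; rewrite /= iter_shiftX_mul (prim_expr_order prim_z).
Qed.

Lemma shift_inj : injective shift.
Proof.
apply: (@can_inj _ _ _ (iter (m * q).-1 shift)) => P.
by rewrite -iterSr prednK ?muln_gt0 ?iter_shift_order.
Qed.

Definition shift_frac : R -> {fraction R} := @FracField.tofrac R \o shift.

HB.instance Definition _ := GRing.RMorphism.on shift_frac.

Lemma shift_frac_inj : injective shift_frac.
Proof. by move=> P Q /eqP; rewrite tofrac_eq => /eqP/shift_inj. Qed.

Definition shift_lift : {fraction R} -> {fraction R} :=
  frac_lift shift_frac_inj.

HB.instance Definition _ := GRing.RMorphism.on shift_lift.

Lemma iter_shift_lift i P : iter i shift_lift P%:F = (iter i shift P)%:F.
Proof. by elim: i => //= i ->; apply: frac_lift_tofrac. Qed.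

(** In the i-th iterate of y_0 the variable determines [i %% m], and the power of [z] determines
    [i %/ m], which is below the order q of [z]. *)
Lemma shift_free_orbit : free_orbit shift_lift (m * q) (X ord0)%:F.
Proof.
split=> [|x|i j]; first by rewrite muln_gt0.
  by rewrite (fracE x) fmorph_div /= !iter_shift_lift !iter_shift_order.
rewrite !inE /= !iter_shift_lift => lt_i lt_j /eqP.
rewrite tofrac_eq !iter_shiftX !add0n => /eqP eq_ij.
have eq_mod : (i %% m = j %% m)%N.
  move/(congr1 (mcoeff (mnm1 (inord (i %% m)%N)))): (eq_ij).
  rewrite !mcoeffZ !mcoeffX eqxx mulr1.
  case: eqP => [eqX _ | _ /eqP]; last first.
    by rewrite mulr0 expf_eq0 (negPf z_neq0) andbF.
  move/(congr1 (fun k : multinom m => k (inord (i %% m)%N))): eqX.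
  rewrite !mnm1E eqxx; case: eqP => // /(congr1 val) /=.
  by rewrite !inordK ?ltn_mod // => ->.
have eq_div : (i %/ m = j %/ m)%N.
  move/(congr1 (mcoeff (mnm1 (inord (i %% m)%N)))): eq_ij.
  rewrite -eq_mod !mcoeffZ !mcoeffX eqxx !mulr1 => /eqP.
  rewrite (eq_prim_root_expr prim_z) !modn_small ?ltn_divLR // 1?mulnC //.
  by move/eqP.
by rewrite (divn_eq i m) (divn_eq j m) eq_mod eq_div.
Qed.

(** The exponent of [z] depends on [P] only through its leading monomial, so it will be the same for
    numerator and denominator. *)
Lemma shift_prod_mlead P : P != 0 ->
  let N := \prod_(0 <= i < q) iter (m * i) shift P in
  [/\ N != 0, mlead N = mnm_muln (mlead P) q
    & mleadc N = z ^+ (\sum_(0 <= i < q) i * mdeg (mlead P))%N * mleadc P ^+ q].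
Proof.
move=> P0; elim: (q) => [|b [N0 leadN leadcN]] /=.
  rewrite !big_nil oner_neq0 mlead1 mulm0n mcoeff1 eqxx expr0 mul1r.
  by split.
set Q := iter (m * b) shift P.
have tauC c : iter (m * b) shift (mpolyC m c) = mpolyC m c.
  exact: iter_shiftC.
have zb0 : z ^+ b != 0 by rewrite expf_neq0.
have leadQ : mlead Q = mlead P.
  exact: (@scaling_mlead _ _ _ (iter (m * b) shift) tauC (iter_shiftX_mul b)).
have leadcQ : mleadc Q = z ^+ (b * mdeg (mlead P)) * mleadc P.
  rewrite exprM.
  exact: (@scaling_mleadc _ _ _ (iter (m * b) shift) tauC (iter_shiftX_mul b)).
have Q0 : Q != 0 by rewrite -mleadc_eq0 leadcQ mulf_neq0 ?expf_neq0 ?mleadc_eq0.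
rewrite !big_nat_recr //= -/Q; split; first exact: mulf_neq0.
  by rewrite mleadM // leadN leadQ mulmSr.
by rewrite mleadM // mleadcM leadcN leadcQ exprD exprSr mulrACA.
Qed.

Lemma shift_norm_const (a : {fraction R}) c : c != 0 ->
    \prod_(0 <= i < q) iter (m * i) shift_lift a = (mpolyC m c)%:F ->
  exists e, e ^+ q = c.
Proof.
move=> c0; rewrite (fracE a); set P := \n__; set Q := \d__ => norm_a.
have Q0 : Q != 0 by apply: denom_ratioP.
have tofracN S : \prod_(0 <= i < q) iter (m * i) shift_lift S%:F =
    (\prod_(0 <= i < q) iter (m * i) shift S)%:F.
  by rewrite rmorph_prod; apply: eq_bigr => i _; rewrite iter_shift_lift.
have [NQ0 leadNQ leadcNQ] := shift_prod_mlead Q0.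
(* Clearing denominators leaves an identity between polynomials. *)
have {}norm_a : \prod_(0 <= i < q) iter (m * i) shift P =
    c *: \prod_(0 <= i < q) iter (m * i) shift Q.
  apply/eqP; rewrite -tofrac_eq -mul_mpolyC rmorphM /= -norm_a.
  rewrite -!tofracN [Y in _ == Y * _](eq_bigr (fun i =>
    iter (m * i)%N shift_lift P%:F / iter (m * i)%N shift_lift Q%:F)).
    by rewrite prodf_div divfK // tofracN tofrac_eq0.
  by move=> i _; rewrite fmorph_div.
have P0 : P != 0.
  apply: contraNneq NQ0 => P0; move/esym/eqP: norm_a.
  rewrite P0 [Y in _ == Y](_ : _ = 0) ?scaler_eq0 ?(negPf c0) //.
  by rewrite -(prednK q_gt0) big_nat_recl // rmorph0 mul0r.
have [NP0 leadNP leadcNP] := shift_prod_mlead P0.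
have leadPQ : mlead P = mlead Q.
  apply/mnmP => i; apply/eqP; rewrite -(eqn_pmul2r q_gt0) -!mulmnE.
  by rewrite -leadNP -leadNQ norm_a mleadZ_proper // mulf_neq0 ?mleadc_eq0.
exists (mleadc P / mleadc Q).
move/(congr1 (fun S => mleadc S)): norm_a.
rewrite mleadZ_proper ?mulf_neq0 ?mleadc_eq0 //.
(* With equal leading monomials the powers of [z] cancel, leaving lc(P)^q = c lc(Q)^q. *)
rewrite mcoeffZ leadcNP leadcNQ leadPQ mulrCA => /mulfI eq_lead.
by rewrite expr_div_n eq_lead ?expf_neq0 // mulfK // expf_neq0 // mleadc_eq0.
Qed.

End Shift.

(** * The constants from E inside the fixed field *)

Section ShiftConst.

Variables (E : fieldType) (m' : nat) (z : E) (q : nat).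
Hypothesis prim_z : q.-primitive_root z.

Local Notation sigma := (@shift_lift E m' z q prim_z).
Local Notation F := (fixed_field sigma).

Fact shift_const_fixed c :
  fixed_pred sigma (mpolyC m'.+1 c)%:F.
Proof.
apply/eqP; rewrite -[LHS]/(iter 1 sigma _) iter_shift_lift.
by rewrite [iter _ _ _]shiftC.
Qed.

Definition shift_const (c : E) : F :=
  exist (fun x => fixed_pred sigma x) _ (shift_const_fixed c).

Fact shift_const_is_zmod_morphism : zmod_morphism shift_const.
Proof. by move=> c d; apply: val_inj; rewrite /= !rmorphB. Qed.

Fact shift_const_is_monoid_morphism : monoid_morphism shift_const.
Proof. by split=> [|c d]; apply: val_inj; rewrite /= ?rmorph1 ?rmorphM. Qed.

HB.instance Definition _ := GRing.isZmodMorphism.Build E F shift_const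
  shift_const_is_zmod_morphism.
HB.instance Definition _ := GRing.isMonoidMorphism.Build E F shift_const
  shift_const_is_monoid_morphism.

End ShiftConst.

(** * Roots of unity in cyclotomic fields *)

(** The order of [e] divides p^(j+1); were it a smaller power of p, it would divide p^j and [x]
    would be 1. *)
Lemma prim_root_pfactor (E : fieldType) p j (x e : E) : prime p ->
  p.-primitive_root x -> e ^+ (p ^ j) = x -> (p ^ j.+1).-primitive_root e.
Proof.
move=> p_pr prim_x ej.
have pj_gt0 : (0 < p ^ j.+1)%N by rewrite expn_gt0 prime_gt0.
have e1 : e ^+ (p ^ j.+1) = 1 by rewrite expnSr exprM ej prim_expr_order.
have [d prim_e] := prim_order_exists pj_gt0 e1.
case/(dvdn_pfactor _ _ p_pr) => i le_ij def_d; rewrite def_d in prim_e.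
have [lt_ij | le_ji] := ltnP i j.+1; last first.
  by rewrite -(@anti_leq i j.+1) // le_ij.
have /eqP : e ^+ (p ^ j) = 1.
  apply/eqP; rewrite -(prim_order_dvd prim_e); exact: dvdn_exp2l.
by rewrite ej -(prim_order_dvd prim_x 1) dvdn1 => /eqP p1; rewrite p1 in p_pr.
Qed.

(** Take E = Q(z), of degree totient n over Q. A primitive k-th root in E has degree totient k over
    Q, which is at most the degree of E. *)
Lemma cyclotomic_field_exists n : (0 < n)%N ->
  exists (E : fieldExtType rat) (z : E), n.-primitive_root z /\
    forall k (e : E), k.-primitive_root e -> (totient k <= totient n)%N.
Proof.
move=> n_gt0; have [z0 prim_z0] := C_prim_root_exists n_gt0.
have [E [iota [[|z []] //= [def_z0] gen_z]]] := num_field_exists [:: z0].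
rewrite -{}def_z0 fmorph_primitive_root in prim_z0 *.
exists E, z; split=> // k e prim_e.
(* [minPoly] lives over E and [minCpoly] over [algC]. Both come from rational polynomials, and
   divisibility one way suffices for each inequality. *)
have iotaE (q : {poly rat}) :
    map_poly iota (map_poly (in_alg E) q) = map_poly ratr q.
  rewrite -map_poly_comp; apply: eq_map_poly => r /=.
  by rewrite alg_num_field fmorph_rat.
have rootE (q : {poly rat}) u :
    root (map_poly (in_alg E) q) u = root (map_poly ratr q) (iota u).
  by rewrite -iotaE fmorph_root.
have size_ratr (q : {poly rat}) : size (map_poly ratr q : {poly algC}) = size q.
  exact: (size_map_poly (ratr : {rmorphism rat -> algC})).
have size_minC l (u : E) :
    l.-primitive_root u -> size (minCpoly (iota u)) = (totient l).+1.
  move=> prim_u; rewrite (@minCpoly_cyclotomic l) ?size_cyclotomic //.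
  by rewrite fmorph_primitive_root.
apply: (@leq_trans (\dim {:E})).
  have /polyOver1P[q Dq] := minPolyOver 1 e.
  have [q0 [Dq0 mon_q0] dv_q0] := minCpolyP (iota e).
  have : q0 %| q by rewrite -dv_q0 -rootE -Dq root_minPoly.
  have q_neq0 : q != 0.
    by rewrite -(map_poly_eq0 (in_alg E)) -Dq monic_neq0 // monic_minPoly.
  move/(dvdp_leq q_neq0).
  rewrite -size_ratr -Dq0 (size_minC k) //.
  rewrite -(size_map_poly (in_alg E)) -Dq size_minPoly ltnS => /leq_trans -> //.
  by rewrite adjoin_degreeE dimv1 divn1 dimvS // subvf.
have -> : \dim {:E} = adjoin_degree 1 z.
  by rewrite adjoin_degreeE dimv1 divn1 -gen_z /= adjoin_seq1.
have [q0 [Dq0 mon_q0] dv_q0] := minCpolyP (iota z).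
rewrite -ltnS -(size_minC n z prim_z0) -size_minPoly Dq0.
rewrite size_ratr -(size_map_poly (in_alg E)).
apply: dvdp_leq; first by rewrite map_poly_eq0 monic_neq0.
apply: minPoly_dvdp; first exact: alg_polyOver.
by rewrite rootE -Dq0 root_minCpoly.
Qed.

(** * Realizing every value of the invariant *)

Lemma shift_extension (E : fieldType) p n k (z : E) :
    prime p -> (k <= n)%N -> (p ^ (n - k)).-primitive_root z ->
  exists (F : fieldType) (K : splittingFieldType F) (iota : {rmorphism E -> F}),
    cyclic_galois_ext K (p ^ n) /\
    forall c, c != 0 -> norm_group (layer K p k) ((iota c)%:A : K) ->
      exists e, e ^+ (p ^ (n - k)) = c.
Proof.
move=> p_pr le_kn prim_z; pose m' := (p ^ k).-1.
have m'E : m'.+1 = (p ^ k)%N by rewrite prednK // expn_gt0 prime_gt0.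
pose K := cyclic_ext (@shift_free_orbit E m' z _ prim_z).
have [g [gX defG]] := cyclic_ext_gal (@shift_free_orbit E m' z _ prim_z).
have extK : cyclic_galois_ext K (p ^ n).
  split; first exact: galois_cyclic_ext.
    by rewrite defG cycle_cyclic.
  by rewrite dim_cyclic_ext m'E -expnD subnKC.
exists _, K, (@shift_const E m' z _ prim_z); split=> // c c0.
case/(norm_group_layerP p_pr extK _ defG le_kn) => a a0.
(* Gal(K/K_k) is generated by sigma^m with m = p^k, so the norm is the product in
   [shift_norm_const]. *)
under eq_bigr do rewrite gX -m'E.
rewrite cyclic_scaleE mulr1 /= => norm_a.
exact: shift_norm_const c0 norm_a.
Qed.

Theorem theorem2 (p n : nat) (t : \bar int) :
  prime p -> (1 <= n)%N ->
  t = -oo%E \/ (exists k : nat, (k < n)%N /\ t = (k%:Z%:E)%E) ->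
  exists (F : fieldType) (xi : F) (K : splittingFieldType F),
    [/\ p \notin [pchar F],
        p.-primitive_root xi,
        cyclic_galois_ext K (p ^ n)
      & m_inv K p n xi = t].
Proof.
move=> p_pr n_gt0 t_val; have p_gt0 := prime_gt0 p_pr.
have prim_p (E : fieldType) j (z : E) :
    (p ^ j.+1).-primitive_root z -> p.-primitive_root (z ^+ (p ^ j)).
  move=> prim_z; rewrite -(mulnK (p ^ j) p_gt0) -expnSr.
  by rewrite dvdn_prim_root ?dvdn_exp.
case: t_val => [-> | [k [lt_kn ->]]].
  (* Here E is [algC] and k = 0. The twist is [z ^+ p], of order p^n, while [z] itself has norm
     z^(p^n) = xi. *)
  have [|z prim_z] := @C_prim_root_exists (p ^ n.+1).
    by rewrite expn_gt0 p_gt0.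
  have prim_zp : (p ^ (n - 0)).-primitive_root (z ^+ p).
    have {2}-> : p = (p ^ n.+1 %/ p ^ n)%N.
      by rewrite expnS mulnK // expn_gt0 p_gt0.
    by rewrite subn0 dvdn_prim_root // dvdn_exp2l.
  have [F [K [iota [extK _]]]] := shift_extension p_pr (leq0n n) prim_zp.
  exists F, (iota (z ^+ (p ^ n))), K; split=> //.
  - by rewrite (fmorph_pchar iota) pchar_num.
  - by rewrite fmorph_primitive_root prim_p.
  apply: (m_inv_ninfty p_pr extK).
  have iz0 : iota z != 0 by rewrite fmorph_eq0 (prim_root_neq0 prim_z).
  by have := norm_group_layerX p_pr extK (leq0n n) iz0; rewrite subn0 rmorphXn.
have [|E [z [prim_z max_z]]] := @cyclotomic_field_exists (p ^ (n - k)).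
  by rewrite expn_gt0 p_gt0.
have [F [K [iota [extK normK]]]] := shift_extension p_pr (ltnW lt_kn) prim_z.
have nkE : (n - k = (n - k.+1).+1)%N by rewrite subnSK.
have prim_xi : p.-primitive_root (z ^+ (p ^ (n - k.+1))).
  by rewrite prim_p // -nkE.
exists F, (iota (z ^+ (p ^ (n - k.+1)))), K; split=> //.
- by rewrite (fmorph_pchar iota) (fmorph_pchar (in_alg E)) pchar_num.
- by rewrite fmorph_primitive_root.
have z0 : z != 0 by apply: prim_root_neq0 prim_z.
apply: (m_inv_fin p_pr extK lt_kn).
(* A p^(n-k)-th root of xi would have order p^(n-k+1), whose totient (p-1) p^(n-k) exceeds the bound
   (p-1) p^(n-k-1) valid in E. *)
- move/normK; rewrite expf_neq0 // => /(_ isT)[e eE].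
  have := max_z _ _ (prim_root_pfactor p_pr prim_xi eE).
  rewrite !totient_pfactor // nkE //= leq_pmul2l ?leq_exp2l ?prime_gt1 ?ltnn //.
  by rewrite -subn1 subn_gt0 prime_gt1.
(* xi is the norm of the constant [z] from K to K_(k+1). *)
- by rewrite rmorphXn; apply: norm_group_layerX; rewrite ?fmorph_eq0.
by rewrite fmorph_eq0 expf_neq0.
Qed.
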